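(* If $\mathfrak u<\min\{\mathfrak s,\mathrm{cf}^\ast(\mathrm{Sym}(\omega))\}$, then NCF holds.
   Context: All filters are assumed non-principal. $\mathfrak u$ is the minimal size of a family generating (i.e. a base of) a non-principal ultrafilter on $\omega$; $\mathfrak s$ is the splitting number (the minimal size of a family $\mathcal A\subset[\omega]^\omega$ such that for every infinite $X\subset\omega$ there is $A\in\mathcal A$ with both $X\cap A$ and $X\setminus A$ infinite). Ultrafilters $\mathcal F$ and $\mathcal U$ on $\omega$ are coherent if there is an increasing sequence $\langle k_n:n\in\omega\rangle$ of natural numbers such that for every $I\subset\omega$, $\bigcup_{n\in I}[k_n,k_{n+1})\in\mathcal F$ if and only if $\bigcup_{n\in I}[k_n,k_{n+1})\in\mathcal U$. NCF is the statement that all (non-principal) ultrafilters on $\omega$ are coherent to each other. $\mathrm{Sym}(\omega)$ is the group of all permutations of $\omega$. For $x,y\in\omega^\omega$, $x\leq^\ast y$ means $x(n)\leq y(n)$ for all but finitely many $n$. For an increasing function $f\in\omega^\omega$, $S_f$ is the subgroup of $\mathrm{Sym}(\omega)$ generated by $\{\pi\in\mathrm{Sym}(\omega):\pi,\pi^{-1}\leq^\ast f\}$. $\mathrm{cf}^\ast(\mathrm{Sym}(\omega))$ is the minimal length $\lambda$ of an increasing (with respect to inclusion) chain $\langle G_i:i<\lambda\rangle$ of proper subgroups of $\mathrm{Sym}(\omega)$ with $\bigcup_{i<\lambda}G_i=\mathrm{Sym}(\omega)$ such that for every increasing $f\in\omega^\omega$ there is $i<\lambda$ with $S_f\subset G_i$.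 *)

(* Defs.v *)
From HB Require Import structures.
From mathcomp Require Import all_boot.
From mathcomp Require Import all_classical.
From mathcomp Require wochoice.

Set Implicit Arguments.
Unset Strict Implicit.
Unset Printing Implicit Defensive.

Local Open Scope classical_set_scope.
Local Open Scope card_scope.

(* Cardinals are represented by types, up to bijection. *)
Definition card_lt (K L : Type) : Prop :=
  [set: K] #<= [set: L] /\ ~ ([set: L] #<= [set: K]).

Definition is_min_card (T : Type) (C : set (set T)) (K : Type) : Prop :=
  (exists2 A, C A & A #= [set: K]) /\ (forall A, C A -> [set: K] #<= A).

Definition increasing (f : nat -> nat) : Prop := {homo f : m n / m < n}.

Definition nonprincipal_ultrafilter (F : set_system nat) : Prop :=
  UltraFilter F /\ forall n, F <> principal_filter n.

(* [filter_from B id] is the family of all supersets of members of [B]. *)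
Definition ultrafilter_base (B : set (set nat)) : Prop :=
  nonprincipal_ultrafilter (filter_from B id).

Definition splitting_family (A : set (set nat)) : Prop :=
  (forall X, A X -> infinite_set X) /\
  (forall X, infinite_set X ->
     exists2 Y, A Y & infinite_set (X `&` Y) /\ infinite_set (X `\` Y)).

Definition is_ultrafilter_number (K : Type) : Prop :=
  is_min_card ultrafilter_base K.

Definition is_splitting_number (K : Type) : Prop :=
  is_min_card splitting_family K.

(* Strictness of [k] matters: with a constant [k] all the intervals would be
   empty and the equivalence would be trivial. *)
Definition coherent (F U : set_system nat) : Prop :=
  exists2 k : nat -> nat, increasing k &
    forall I : set nat,
      let E := \bigcup_(n in I) [set m | k n <= m < k n.+1] in F E <-> U E.

Definition NCF : Prop :=
  forall F U, nonprincipal_ultrafilter F -> nonprincipal_ultrafilter U ->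
  coherent F U.

(* The inverse is carried as data; [sym_ext] shows that it is determined by the
   underlying function, so that [Sym] is exactly the set of bijections of nat. *)
Record Sym : Type := MkSym {
  sym_fun :> nat -> nat;
  sym_inv : nat -> nat;
  symK : cancel sym_fun sym_inv;
  sym_invK : cancel sym_inv sym_fun }.

Lemma sym_ext (p q : Sym) : sym_fun p =1 sym_fun q -> p = q.
Proof.
case: p q => [f f' fK f'K] [g g' gK g'K] /= fg.
have ef : f = g by exact/funext.
subst g; have ef' : f' = g'.
  by apply/funext => n; rewrite -[in LHS](g'K n) fK.
by subst g'; congr MkSym; exact: Prop_irrelevance.
Qed.

Definition sym_one : Sym := @MkSym id id (fun=> erefl) (fun=> erefl).

Definition sym_mul (p q : Sym) : Sym :=
  MkSym (can_comp (symK p) (symK q)) (can_comp (sym_invK q) (sym_invK p)).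

Definition sym_opp (p : Sym) : Sym := MkSym (sym_invK p) (symK p).

HB.instance Definition _ := gen_eqMixin Sym.
HB.instance Definition _ := gen_choiceMixin Sym.

Lemma sym_mulA : associative sym_mul.
Proof. by move=> p q r; apply: sym_ext. Qed.

Lemma sym_mul1 : left_id sym_one sym_mul.
Proof. by move=> p; apply: sym_ext. Qed.

Lemma sym_mulr1 : right_id sym_one sym_mul.
Proof. by move=> p; apply: sym_ext. Qed.

Lemma sym_mulV : left_inverse sym_one sym_opp sym_mul.
Proof. by move=> p; apply: sym_ext => n /=; exact: symK. Qed.

Lemma sym_mulrV : right_inverse sym_one sym_opp sym_mul.
Proof. by move=> p; apply: sym_ext => n /=; exact: sym_invK. Qed.

HB.instance Definition _ :=
  isGroup.Build Sym sym_mulA sym_mul1 sym_mulr1 sym_mulV sym_mulrV.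

Definition subgroup (G : set Sym) : Prop := group_closed [in G].

Definition le_star (x y : nat -> nat) : Prop :=
  cofinite_set [set n | x n <= y n].

Definition S_ (f : nat -> nat) : set Sym :=
  smallest subgroup [set p : Sym | le_star p f /\ le_star (p^-1)%g f].

(* [R] is the reflexive order of the index set [L]. *)
Definition sym_chain (L : Type) (R : rel L) (G : L -> set Sym) : Prop :=
  [/\ (forall i, subgroup (G i) /\ G i <> [set: Sym]),
      (forall i j, R i j -> G i `<=` G j),
      \bigcup_i G i = [set: Sym] &
      forall f, increasing f -> exists i, S_ f `<=` G i].

(* Ordinals are represented by well-ordered types: the order type of [(L, R)]
   is at most that of [(L', R')] iff there is an order embedding. *)
Definition chain_length (L : Type) (R : rel L) : Prop :=
  wochoice.well_order R /\ exists G, @sym_chain L R G.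

(* [K] is the (underlying set of the) least ordinal that is a chain length.
   Passing to a cofinal subchain shows that this ordinal is a regular cardinal,
   so it may be compared with other cardinals through [card_lt]. *)
Definition is_cf_star_Sym (K : Type) : Prop :=
  exists2 R : rel K, chain_length R &
    forall (L : Type) (R' : rel L), chain_length R' ->
      exists f : K -> L, {mono f : x y / R x y >-> R' x y}.

(* Main.v *)
From mathcomp Require Import all_boot.
From mathcomp Require Import all_classical.
From mathcomp Require Import zify.
From mathcomp Require wochoice.
Require Import Defs.

Set Implicit Arguments.
Unset Strict Implicit.
Unset Printing Implicit Defensive.

Local Open Scope classical_set_scope.
Local Open Scope card_scope.

(** Suppose that NCF fails, and let [V] be an ultrafilter with a base of size
    [u]. Near coherence is transitive, so some ultrafilter [U] is not coherent
    with [V] ([not_NCF_separated]), and then [U] and [V] have members that are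
    as far apart as one likes ([noncoherent_separated]). The argument studies
    the functions of [nat] to [nat] modulo [U], a linear order.

    For [B] in the base of [V], let [next B n] be the least element of [B] that
    is at least [n]. Separation makes these [u] many functions cofinal modulo [U]
    ([next_dominating]). Since [u < s], they have a further property
    ([interpolation]): for every [g] there is [f] such that each [A] in [U] has,
    for [U]-almost every [n], an element between [g n] and [f n]. Otherwise some
    [g] fails for all [f]; each [B] in the base then yields [A_B] in [U] with no
    element in [[g n, next B n]] for [n] in [A_B], and the sets formed by the
    intervals [[n, next B n]], [n] in [A_B], are a splitting family of size at
    most [u] ([gap_set_splits]).

    Interpolation turns an inequality [h <= g] modulo [U], which is information
    on a single point of the ultrapower, into information on all of it: if
    [A := {m | h m <= g m}] is in [U] and [A] meets [[x n, y n]], then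
    [h (x n) <= g (y n)] by monotonicity ([cut_comp]). So consider the initial
    segments of the ultrapower that are closed under [g] and under passing from
    [x] to an interpolating [y], and let [stab g] be the group of permutations
    preserving all of them. It increases with [g] modulo [U] ([stab_le]),
    contains [S_ f] as soon as [f n + n <= g n] modulo [U] ([S_sub_stab]), and is
    proper since countably many functions never are cofinal modulo [U]
    ([stab_proper]). Applied to a well-ordered cofinal subfamily of the functions
    [next B], this gives a chain of length at most [u] ([short_chain]), against
    [u < cf]. *)

(** * Functions and infinite sets of natural numbers *)

Definition nondecreasing (h : nat -> nat) : Prop := {homo h : m n / m <= n}.

Lemma increasing_nondecreasing f : increasing f -> nondecreasing f.
Proof. by move=> fi m n; rewrite leq_eqVlt => /predU1P[->//|/fi/ltnW]. Qed.

Lemma increasing_ge_id f n : increasing f -> n <= f n.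
Proof. by move=> fi; elim: n => // n /leq_ltn_trans; apply; exact: fi. Qed.

(** The least nondecreasing function that is pointwise at least [h]. *)
Definition hull (h : nat -> nat) (n : nat) : nat := \max_(i < n.+1) h i.

Lemma hull_ge h m n : m <= n -> h m <= hull h n.
Proof.
move=> mn; have mn1 : m < n.+1 by [].
exact: (leq_bigmax (F := fun i : 'I_n.+1 => h i) (Ordinal mn1)).
Qed.

Lemma hull_nondecreasing h : nondecreasing (hull h).
Proof.
move=> m n mn; apply/bigmax_leqP => i _; apply: hull_ge.
by rewrite (leq_trans _ mn) // -ltnS.
Qed.

Lemma infinite_natP (X : set nat) :
  infinite_set X <-> forall n, exists2 m, X m & n <= m.
Proof.
split=> [Xi n|Xu /finite_seqP[s Xs]].
  apply: contrapT => /forall2NP Xn; apply: Xi.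
  apply: (sub_finite_set _ (finite_II n)) => m Xm /=.
  by rewrite ltnNge; apply/negP; case: (Xn m).
have [m] := Xu (\max_(i <- s) i).+1.
rewrite Xs /= => ms; apply/negP; rewrite -leqNgt.
exact: (leq_bigmax_seq (F := id)).
Qed.

(** The least element of [B] that is at least [n], or [0] if there is none. *)
Definition next (B : set nat) (n : nat) : nat :=
  if pselect (exists m, `[< B m /\ n <= m >]) is left ex then ex_minn ex else 0.

Section next.
Variables (B : set nat) (Binf : infinite_set B).

Lemma nextP n : [/\ B (next B n), n <= next B n &
  forall m, B m -> n <= m -> next B n <= m].
Proof.
rewrite /next; case: pselect => [ex|]; last first.
  by have /infinite_natP/(_ n)[m Bm nm] := Binf; case; exists m; apply/asboolP.
case: ex_minnP => m /asboolP[Bm nm] min; split=> // k Bk nk.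
by apply: min; apply/asboolP.
Qed.

Lemma next_in n : B (next B n). Proof. by case: (nextP n). Qed.

Lemma next_ge n : n <= next B n. Proof. by case: (nextP n). Qed.

Lemma next_min n m : B m -> n <= m -> next B n <= m.
Proof. by case: (nextP n) => _ _; apply. Qed.

Lemma next_nondecreasing : nondecreasing (next B).
Proof.
move=> m n mn; apply: next_min; first exact: next_in.
exact/(leq_trans mn)/next_ge.
Qed.

End next.

(** * Nonprincipal ultrafilters *)

Section ultrafilter.
Variables (U : set_system nat) (Unp : nonprincipal_ultrafilter U).

#[local] Instance np_ultra : UltraFilter U. Proof. by case: Unp. Qed.

Lemma np_setI A B : U A -> U B -> U (A `&` B). Proof. exact: filterI. Qed.

Lemma np_subset A B : A `<=` B -> U A -> U B. Proof. exact: filterS. Qed.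

Lemma np_nonempty A : U A -> exists n, A n. Proof. exact: filter_ex. Qed.

Lemma np_setVsetC A : U A \/ U (~` A). Proof. exact: in_ultra_setVsetC. Qed.

Lemma np_cofinite N : U [set n | N <= n].
Proof.
have [//|UN] := np_setVsetC [set n | N <= n].
suff [n Un] : exists n, U [set n].
  case: Unp => _ /(_ n); case.
  apply/esym/max_filter => [|A UA]; first exact: principal_filter_proper.
  apply/principal_filterP.
  by have /np_nonempty[m [+ <-]] := np_setI UA Un.
elim: N UN => [UN|N IH UN].
  by have /np_nonempty[m /(_ isT)] := UN.
have [Un|Un] := np_setVsetC [set N]; first by exists N.
apply: IH; apply: np_subset (np_setI UN Un) => n [/= /negP + /eqP].
by rewrite -leqNgt => h1 h2 /=; lia.
Qed.

Lemma np_infinite A : U A -> infinite_set A.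
Proof.
move=> UA; apply/infinite_natP => n.
by have /np_nonempty[m [Am nm]] := np_setI UA (np_cofinite n); exists m.
Qed.

Lemma np_notboth A : U A -> U (~` A) -> False.
Proof. by move=> UA /(np_setI UA)/np_nonempty[n []]. Qed.

End ultrafilter.

(** * Coherence and separation *)

(** The [i]-th interval of the partition of [[k 0, +oo)] given by [k]. *)
Definition block (k : nat -> nat) (i : nat) : set nat :=
  [set m | k i <= m < k i.+1].

Section blocks.
Variables (k : nat -> nat) (ki : increasing k).

Lemma block_uniq i j n : block k i n -> block k j n -> i = j.
Proof.
have kn := increasing_nondecreasing ki.
rewrite /block /= => /andP[i1 i2] /andP[j1 j2].
case: (ltngtP i j) => // /kn; lia.
Qed.

Lemma block_cover n : k 0 <= n -> exists i, block k i n.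
Proof.
move=> k0; have ex : exists i, k i <= n by exists 0.
have bd i : k i <= n -> i <= n by apply: leq_trans; exact: increasing_ge_id.
exists (ex_maxn ex bd); case: ex_maxnP => i kin imax.
rewrite /block /= kin ltnNge; apply/negP => /imax; lia.
Qed.

End blocks.

(** For every function [h], some member of [U] and some member of [V] are so far
    apart that [h] of an element of either is below every later element of the
    other. The two members are then disjoint. *)
Definition separated (U V : set_system nat) : Prop :=
  forall h : nat -> nat, exists A B, [/\ U A, V B &
    forall n m, A n -> B m -> (n <= m -> h n < m) /\ (m <= n -> h m < n)].

Section noncoherent.
Variables (U V : set_system nat).
Hypothesis Unp : nonprincipal_ultrafilter U.
Hypothesis Vnp : nonprincipal_ultrafilter V.

(** Noncoherence gives a union of blocks that belongs to exactly one of [U] and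
    [V]; the sets [A] and [B] are this union and its complement. *)
Lemma noncoherent_blocks k : increasing k -> ~ coherent U V ->
  exists A B, [/\ U A, V B &
    forall n m i, A n -> B m -> block k i n -> ~ block k i m].
Proof.
move=> ki nUV.
have [I IP] : exists I, ~ (U (\bigcup_(n in I) block k n) <->
                           V (\bigcup_(n in I) block k n)).
  by apply/existsNP => H; apply: nUV; exists k.
have sep J n m i : (\bigcup_(n in J) block k n) n ->
    (~` \bigcup_(n in J) block k n) m -> block k i n -> ~ block k i m.
  move=> [j Jj jn] Jm kin kim; apply: Jm; exists j => //.
  by rewrite -(block_uniq ki kin jn).
set E := \bigcup_(n in I) _ in IP.
have [UE|UE] := np_setVsetC Unp E.
  have [VE|VE] := np_setVsetC Vnp E; first by case: IP.
  by exists E, (~` E); split=> //; exact: sep.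
have [VE|VE] := np_setVsetC Vnp E; last first.
  by case: IP; split=> [UE'|VE'];
    [case: (np_notboth Unp UE' UE)|case: (np_notboth Vnp VE' VE)].
exists (~` E), E; split=> // n m i nE mE kin kim.
exact: (sep _ _ _ _ mE nE kim kin).
Qed.

(** Take a partition [p] whose endpoints grow faster than [h]. The two partitions
    obtained by merging adjacent blocks of [p] in pairs, in the two possible
    ways, together separate each block of [p] from both of its neighbours. *)
Lemma noncoherent_separated : ~ coherent U V -> separated U V.
Proof.
move=> nUV h0; pose h := hull h0.
have hn : nondecreasing h := @hull_nondecreasing h0.
have [p p0 pS] : exists2 p : nat -> nat, p 0 = 0 &
    forall i, h (p i) < p i.+1 /\ p i < p i.+1.
  exists (fix p i :=
    if i is i'.+1 then (maxn (h (p i')) (p i')).+1 else 0) => //.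
  by move=> i /=; rewrite !ltnS leq_maxl leq_maxr.
have pi : increasing p by apply: homo_ltn ltn_trans (fun i => (pS i).2).
have pn := increasing_nondecreasing pi.
have ek : increasing (fun i => p i.*2) by move=> i j ij; apply: pi; lia.
have ok : increasing (fun i => p i.*2.+1) by move=> i j ij; apply: pi; lia.
have [A1 [B1 [UA1 VB1 AB1]]] := noncoherent_blocks ek nUV.
have [A2 [B2 [UA2 VB2 AB2]]] := noncoherent_blocks ok nUV.
exists (A1 `&` A2 `&` [set n | p 1 <= n]), (B1 `&` B2); split.
- by apply: (np_setI Unp); [exact: np_setI|exact: np_cofinite].
- exact: np_setI.
move=> n m [[A1n A2n] /= n1] [B1m B2m].
have [|i /andP[in1 in2]] := @block_cover _ pi n; first by rewrite p0.
(* No element of [B1] and [B2] is in the block of [n] or in an adjacent one. *)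
have far : ~ (p i.-1 <= m < p i.+2).
  move=> /andP[im1 im2].
  have i0 : 0 < i.
    by rewrite lt0n; apply/eqP => i0; move: in2; rewrite i0 ltnNge n1.
  have in1' : p i.-1 <= n := leq_trans (pn _ _ (leq_pred i)) in1.
  have in2' : n < p i.+2 by rewrite (leq_trans in2)// pn.
  have := odd_double_half i; case: (odd i) => /= ie.
    have e : i./2.*2.+1 = i by lia.
    have := AB2 n m i./2 A2n B2m; rewrite /block /= doubleS e in1 in2'.
    move=> /(_ isT); rewrite im2 andbT => /negP; rewrite -ltnNge => mi.
    have := AB1 n m i./2 A1n B1m; rewrite /block /= doubleS e in2.
    have -> : i./2.*2 = i.-1 by lia.
    by rewrite im1 (leq_trans mi) ?pn// andbT => /(_ in1' isT).
  have e : i./2.*2 = i by lia.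
  have := AB1 n m i./2 A1n B1m; rewrite /block /= doubleS e in1 in2'.
  move=> /(_ isT); rewrite im2 andbT => /negP; rewrite -ltnNge => mi.
  have := AB2 n m i./2.-1 A2n B2m; rewrite /block /=.
  have -> : i./2.-1.*2.+1 = i.-1 by lia.
  have -> : i./2.-1.+1.*2.+1 = i.+1 by lia.
  by rewrite im1 in2 (leq_trans mi) ?pn// andbT => /(_ in1' isT).
have hh j : h0 j <= h j by exact: hull_ge.
split=> nm.
  have : p i.+2 <= m.
    rewrite leqNgt; apply/negP => im2; apply: far; rewrite im2 andbT.
    exact: leq_trans (pn _ _ (leq_pred i)) (leq_trans in1 nm).
  by have [+ _] := pS i.+1; have := hn _ _ (ltnW in2); have := hh n; lia.
have mi : m < p i.-1.
  rewrite ltnNge; apply/negP => im1; apply: far; rewrite im1 /=.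
  by apply: (leq_ltn_trans nm); apply: (leq_trans in2); apply: pn.
have i0 : i.-1.+1 = i.
  by rewrite prednK// lt0n; apply: contraTneq mi => ->; rewrite /= p0.
have [+ _] := pS i.-1; rewrite i0.
by have := hn _ _ (ltnW mi); have := hh m; lia.
Qed.

End noncoherent.

(** If [U] and [V] are coherent, then the saturation of a member of [U] by the
    blocks of a witnessing partition belongs to [V]; [h] bounds the diameter of
    the blocks. *)
Lemma coherent_saturation U V :
    nonprincipal_ultrafilter U -> nonprincipal_ultrafilter V ->
    coherent U V ->
  exists2 h : nat -> nat, nondecreasing h &
    forall A, U A -> V [set v | exists2 n, A n & v <= h n /\ n <= h v].
Proof.
move=> Unp Vnp [k ki UV]; exists (fun n => k n.+1) => [m n mn|A UA].
  exact: increasing_nondecreasing.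
have kn := increasing_nondecreasing ki.
pose I := [set i | exists2 n, A n & block k i n].
have UE : U (\bigcup_(n in I) block k n).
  apply: (np_subset Unp) (np_setI Unp UA (np_cofinite Unp (k 0))) => n [An /=].
  by move=> /(block_cover ki)[i ni]; exists i => //; exists n.
apply: (np_subset Vnp) ((UV I).1 UE) => v [i [n An /andP[n1 n2]] /andP[v1 v2]].
have in' : i <= n := leq_trans (increasing_ge_id i ki) n1.
have iv : i <= v := leq_trans (increasing_ge_id i ki) v1.
by exists n => //; have := kn i.+1 n.+1 in'; have := kn i.+1 v.+1 iv; lia.
Qed.

Lemma separated_not_coherent F U V :
    nonprincipal_ultrafilter F -> nonprincipal_ultrafilter U ->
    nonprincipal_ultrafilter V ->
  separated F U -> coherent F V -> coherent U V -> False.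
Proof.
move=> Fnp Unp Vnp FU FV UV.
have [hF hFn satF] := coherent_saturation Fnp Vnp FV.
have [hU hUn satU] := coherent_saturation Unp Vnp UV.
have [A [B [FA UB AB]]] := FU (fun n => hF (hU n) + hU (hF n)).
have [v [[n An [vn nv]] [m Bm [vm mv]]]] :=
  np_nonempty Vnp (np_setI Vnp (satF _ FA) (satU _ UB)).
have [nm mn] := AB _ _ An Bm.
have := hFn _ _ vm; have := hUn _ _ vn; lia.
Qed.

(** If coherence fails somewhere, then every nonprincipal ultrafilter is
    separated from some other one: near coherence is transitive. *)
Lemma not_NCF_separated V : nonprincipal_ultrafilter V -> ~ NCF ->
  exists2 U, nonprincipal_ultrafilter U & separated U V.
Proof.
move=> Vnp; apply: contra_notP => /forall2NP noU F U Fnp Unp.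
apply: contrapT => /(noncoherent_separated Fnp Unp) FU.
have coh W : nonprincipal_ultrafilter W -> coherent W V.
  move=> Wnp; apply: contrapT => /(noncoherent_separated Wnp Vnp).
  by case: (noU W).
exact: (separated_not_coherent Fnp Unp Vnp FU (coh _ Fnp) (coh _ Unp)).
Qed.

(** * Gaps and the splitting number *)

(** The order of the ultrapower of [nat] by [U], on representatives. *)
Definition ev_le (U : set_system nat) (x y : nat -> nat) : Prop :=
  U [set n | x n <= y n].

(** Every member of [U], extended to the ultrapower, has an element between the
    classes of [x] and [y]. *)
Definition interpolates (U : set_system nat) (x y : nat -> nat) : Prop :=
  forall A, U A -> U [set n | exists2 m, A m & x n <= m <= y n].

(** The union of the intervals [[n, next B n]] for [n] in [A]. *)
Definition gap_set (A B : set nat) : set nat :=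
  [set x | exists2 n, A n & n <= x <= next B n].

(** For [n] in both [A] and [C], the first element of [X] after [n] lies in
    [gap_set A B]; the first element of [X] after the largest element [p] of [B]
    below [n] does not, because it is still far below [n]: an interval
    [[k, next B k]] containing it would start after [p], hence reach beyond [n],
    and then [n] would be an element of [A] in [[g k, next B k]]. *)
Lemma gap_set_splits g A B C X : nondecreasing g -> (forall n, n < g n) ->
    infinite_set B -> infinite_set X -> infinite_set (A `&` C) ->
    (forall n m, A n -> A m -> ~ (g n <= m <= next B n)) ->
    (forall n m, C n -> B m -> (n <= m -> g (next X n.+1) < m) /\
                               (m <= n -> g (next X m.+1) < n)) ->
  infinite_set (X `&` gap_set A B) /\ infinite_set (X `\` gap_set A B).
Proof.
move=> gn gid Binf Xinf /infinite_natP ACinf Agap CB.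
split; apply/infinite_natP => N.
  have [n [An Cn] Nn] := ACinf N.
  have [nb _] := CB _ _ Cn (next_in Binf n).
  have Xn := next_ge Xinf n.+1.
  exists (next X n.+1); last by lia.
  split; first exact: next_in.
  exists n => //; have := nb (next_ge Binf n); have := gid (next X n.+1); lia.
have [n [An Cn] Nn] := ACinf (next B N).+1.
have exb : exists m, `[< B m /\ m <= n >].
  by exists (next B N); apply/asboolP; split; [exact: next_in|exact: ltnW].
have bd m : `[< B m /\ m <= n >] -> m <= n by move=> /asboolP[].
case: (ex_maxnP exb bd) => p /asboolP[Bp pn] pmax.
have Np : N <= p.
  apply: leq_trans (next_ge Binf N) _; apply: pmax; apply/asboolP.
  by split; [exact: next_in|exact: ltnW].
have Xp := next_ge Xinf p.+1; have [_ /(_ pn) gp] := CB _ _ Cn Bp.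
have gx := gid (next X p.+1).
exists (next X p.+1); last by lia.
split; first exact: next_in.
move=> [k Ak /andP[kx xk]].
have pk : p < k.
  by rewrite ltnNge; apply/negP => /(next_min Binf Bp); lia.
apply: (Agap k n Ak An); apply/andP; split.
  by apply: leq_trans (gn _ _ kx) _; exact: ltnW.
rewrite leqNgt; apply/negP => kn.
have /pmax : `[< B (next B k) /\ next B k <= n >].
  by apply/asboolP; split; [exact: next_in|exact: ltnW].
by lia.
Qed.

Section small_base.
Variables (U V : set_system nat) (K : Type) (e : K -> set nat).
Hypothesis Unp : nonprincipal_ultrafilter U.
Hypothesis Vnp : nonprincipal_ultrafilter V.
Hypotheses (UV : separated U V).
Hypotheses (eV : forall b, V (e b)).
Hypotheses (Ve : forall A, V A -> exists b, e b `<=` A).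

Let einf b : infinite_set (e b). Proof. exact: np_infinite (eV b). Qed.

Lemma next_dominating h : exists b, ev_le U h (next (e b)).
Proof.
have [A [B [UA VB AB]]] := UV h; have [b bB] := Ve VB; exists b.
apply: (np_subset Unp) UA => n An /=; apply: ltnW.
have [nb _] := AB _ _ An (bB _ (next_in (@einf b) n)).
by apply: nb; exact: next_ge (@einf b) n.
Qed.

(** The place where [u < s] is used: a failure of interpolation for some [g]
    makes the sets [gap_set (A b) (e b)] a splitting family indexed by [K]. *)
Lemma interpolation : (forall S, splitting_family S -> ~ (S #<= [set: K])) ->
  forall g, exists f, interpolates U g f.
Proof.
(* [g0] is replaced by a nondecreasing [g] with [n < g n]. *)
move=> nosplit g0; pose g n := hull g0 n + n.+1.
have gn : nondecreasing g.
  by move=> m n mn; apply: leq_add => //; exact: hull_nondecreasing.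
have gid n : n < g n by rewrite /g; lia.
apply: contrapT => noint.
have gap f : exists A, U A /\ forall n m, A n -> A m -> ~ (g n <= m <= f n).
  apply: contrapT => nA; apply: noint; exists f => A UA.
  have [//|UC] := np_setVsetC Unp [set n | exists2 m, A m & g0 n <= m <= f n].
  case: nA; exists (A `&` ~` [set n | exists2 m, A m & g0 n <= m <= f n]).
  split; first exact: np_setI.
  move=> n m [An /= nm] [Am _] gmf; apply: nm; exists m => //.
  by have := hull_ge g0 (leqnn n); move: gmf; rewrite /g; lia.
have [A AP] := choice (fun b => gap (next (e b))).
pose S b := gap_set (A b) (e b).
apply: (nosplit (range S)); last exact: card_image_le.
split=> [_ [b _ <-]|X Xinf].
  have [Ab _] := AP b.
  apply/infinite_natP => N.
  have /infinite_natP/(_ N)[n An Nn] := np_infinite Unp Ab.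
  by exists n => //; exists n => //; rewrite leqnn next_ge.
have [C [B [UC VB CB]]] := UV (fun n => g (next X n.+1)).
have [b bB] := Ve VB; have [UA Agap] := AP b.
exists (S b); first by exists b.
apply: (gap_set_splits gn gid (@einf b) Xinf _ Agap) => [|n m Cn bm].
  exact: (np_infinite Unp (np_setI Unp UA UC)).
exact: CB Cn (bB _ bm).
Qed.

End small_base.

(** * Stabilizers of cuts *)

Section cuts.
Variables (U : set_system nat) (Unp : nonprincipal_ultrafilter U).

Lemma ev_le_pointwise x y : (forall n, x n <= y n) -> ev_le U x y.
Proof.
by move=> xy; apply: (np_subset Unp) (np_cofinite Unp 0) => n _; exact: xy.
Qed.

Lemma ev_le_trans y x z : ev_le U x y -> ev_le U y z -> ev_le U x z.
Proof.
move=> xy yz; apply: (np_subset Unp) (np_setI Unp xy yz) => n [/= + +].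
exact: leq_trans.
Qed.

Lemma ev_le_total x y : ev_le U x y \/ ev_le U y x.
Proof.
have [|xy] := np_setVsetC Unp [set n | x n <= y n]; [by left|right].
by apply: (np_subset Unp) xy => n /= /negP; rewrite -ltnNge => /ltnW.
Qed.

Lemma interpolates_le x x' y : ev_le U x x' ->
  interpolates U x' y -> interpolates U x y.
Proof.
move=> xx' x'y A UA; apply: (np_subset Unp) (np_setI Unp xx' (x'y _ UA)) => n.
by move=> [/= xn [m Am mn]]; exists m => //; lia.
Qed.

Lemma interpolates_ler x y y' : (forall n, y n <= y' n) ->
  interpolates U x y -> interpolates U x y'.
Proof.
move=> yy' xy A UA; apply: (np_subset Unp) (xy _ UA) => n.
by move=> [m Am mn]; exists m => //; have := yy' n; lia.
Qed.

(** An initial segment [J] of the ultrapower, as a set of representatives, that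
    is closed under [g] and under interpolation. The empty and the full segment
    are allowed. *)
Definition cut (g : nat -> nat) (J : set (nat -> nat)) : Prop :=
  [/\ (forall x y, ev_le U x y -> J y -> J x),
      (forall x, J x -> J (g \o x)) &
      (forall x, J x -> exists2 y, J y & interpolates U x y)].

(** A cut closed under [g] is closed under every [h] that is below [g] merely
    modulo [U]; interpolation carries the inequality from the class of the
    identity to the other elements of the cut. *)
Lemma cut_comp g h J : nondecreasing g -> nondecreasing h -> ev_le U h g ->
  cut g J -> forall x, J x -> J (h \o x).
Proof.
move=> gn hn hg [Jle Jg JT] x Jx; have [y Jy xy] := JT x Jx.
apply: Jle (Jg _ Jy); apply: (np_subset Unp) (xy _ hg).
move=> n [m /= hgm /andP[xm my]].
exact: leq_trans (leq_trans (hn _ _ xm) hgm) (gn _ _ my).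
Qed.

(** The permutations that map each cut closed under [g] onto itself. *)
Definition stab (g : nat -> nat) : set Sym :=
  [set p : Sym | forall J, cut g J -> forall x, J x ->
     J (p \o x) /\ J ((p^-1)%g \o x)].

Lemma stab_subgroup g : subgroup (stab g).
Proof.
split=> [|p q]; rewrite !inE; first by move=> J _ x Jx; split.
move=> ps qs J cJ x Jx; split.
  by have [_ /(ps J cJ)[]] := qs J cJ x Jx.
by have [_ /(qs J cJ)[]] := ps J cJ x Jx.
Qed.

Lemma stab_le g g' : nondecreasing g -> nondecreasing g' -> ev_le U g g' ->
  stab g `<=` stab g'.
Proof.
move=> gn gn' gg' p ps J cJ; apply: ps; have [Jle _ JT] := cJ; split=> //.
exact: cut_comp cJ.
Qed.

(** The summand [n] absorbs the constants [K] for which [p <= f + K] everywhere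
    when [p] is only eventually below [f], uniformly in [p]. *)
Lemma S_sub_stab f g : increasing f -> nondecreasing g ->
  ev_le U (fun n => f n + n) g -> S_ f `<=` stab g.
Proof.
move=> fi gn fg; have fn := increasing_nondecreasing fi.
have closed (p : Sym) J x : le_star p f -> cut g J -> J x -> J (p \o x).
  move=> pf cJ Jx.
  have [K pK] : exists K, forall n, p n <= f n + K.
    have /finite_seqP[s sE] := pf; exists (\max_(i <- s) p i) => n.
    have [ps|ps] := boolP (n \in s).
      by apply: (leq_trans (leq_bigmax_seq (F := p) _ ps isT)); exact: leq_addl.
    apply: leq_trans (leq_addr _ _); apply: contrapT => pn.
    by case/negP: ps; have : (~` [set n | p n <= f n]) n by []; rewrite sE.
  have [Jle _ _] := cJ.
  apply: (Jle _ ((fun n => f n + K) \o x)).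
    by apply: ev_le_pointwise => n; exact: pK.
  apply: (cut_comp gn _ _ cJ) => //; first by move=> m n /fn; lia.
  apply: ev_le_trans fg.
  by apply: (np_subset Unp) (np_cofinite Unp K) => n /=; lia.
apply: smallest_sub; first exact: stab_subgroup.
by move=> p [pf pf'] J cJ x Jx; split; exact: closed.
Qed.

End cuts.

Lemma increasing_enum_inverse e : increasing e ->
  exists q : nat -> nat, forall k, q (e k) = k.
Proof.
move=> ei.
have einj : injective e.
  by move=> i j eij; case: (ltngtP i j) => // /ei; rewrite eij ltnn.
have /choice[q qP] : forall j, exists m, (exists k, e k = j) -> e m = j.
  move=> j; have [[k ek]|nk] := pselect (exists k, e k = j).
    by exists k.
  by exists 0 => /nk.
by exists q => k; apply: einj; apply: qP; exists k.
Qed.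

(** The permutation is the involution that swaps each even number [2 k] with the
    odd number [2 (e k) + 1], where [e] is increasing and grows faster than [z]. *)
Lemma fast_permutation (z : nat -> nat) :
  exists p : Sym, forall n, exists2 m, m <= n & z n < p m.
Proof.
pose e k := \sum_(i < k.+1) (hull z i.*2.+1).+1.
have eS k : e k.+1 = e k + (hull z k.+1.*2.+1).+1 by rewrite /e big_ord_recr.
have ei : increasing e by apply: homo_ltn ltn_trans _ => k; rewrite eS; lia.
have ez k : hull z k.*2.+1 <= e k.
  by case: k => [|k]; rewrite ?eS /e ?big_ord_recr /=; lia.
have [q qe] := increasing_enum_inverse ei.
pose p n := if odd n then if e (q n./2) == n./2 then (q n./2).*2 else n
            else (e n./2).*2.+1.
have pK : cancel p p.
  move=> n; have nE := odd_double_half n; rewrite {2}/p.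
  case: ifPn => [on|/negPf en]; last first.
    by move: nE; rewrite /p /= odd_double /= uphalf_double qe eqxx en.
  case: ifPn => [/eqP eq|/negPf neq]; last by rewrite /p on neq.
  by move: nE; rewrite /p odd_double doubleK eq on.
exists (MkSym pK pK) => n; exists n./2.*2.
  by have := odd_double_half n; lia.
rewrite /= /p odd_double doubleK.
have := ez n./2; have : z n <= hull z n./2.*2.+1; last lia.
by apply: hull_ge; have := odd_double_half n; case: odd; lia.
Qed.

Section proper.
Variables (U : set_system nat) (Unp : nonprincipal_ultrafilter U).
Hypothesis interp : forall x, exists y, interpolates U x y.

(** Some cut containing the identity is the union of countably many principal
    initial segments, hence bounded by some [z]; a permutation growing faster
    than [z] does not preserve it. *)
Lemma stab_proper g : nondecreasing g -> stab U g <> [set: Sym].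
Proof.
move=> gn stabT; have [F FP] := choice interp.
pose y := fix y k :=
  if k is k'.+1 then fun n => F (y k') n + g (y k' n) else id.
pose J := [set x : nat -> nat | exists k, ev_le U x (y k)].
have cJ : cut U g J.
  split=> [x x' xx' [k xk]|x [k xk]|x [k xk]].
  - by exists k; exact: ev_le_trans xk.
  - exists k.+1; apply: (np_subset Unp) xk => n /= /gn; rewrite /comp; lia.
  - exists (y k.+1); first by exists k.+1; exact: ev_le_pointwise.
    apply: (interpolates_le Unp xk).
    by apply: (interpolates_ler Unp _ (FP _)) => n; exact: leq_addr.
pose z n := \max_(k < n.+1) y k n.
have [p pP] := fast_permutation z.
have /choice[x xP] : forall n, exists m, m <= n /\ z n < p m.
  by move=> n; have [m] := pP n; exists m.
have Jx : J x by exists 0; apply: (ev_le_pointwise Unp) => n; case: (xP n).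
have : stab U g p by rewrite stabT.
move=> /(_ J cJ x Jx)[[k pk] _].
have [n [/= pn kn]] := np_nonempty Unp (np_setI Unp pk (np_cofinite Unp k)).
have [_] := xP n; rewrite ltnNge => /negP; apply.
apply: leq_trans pn _; have kn1 : k < n.+1 by [].
exact: (leq_bigmax (F := fun i : 'I_n.+1 => y i n) (Ordinal kn1)).
Qed.

End proper.

(** * Well-ordered chains *)

Lemma well_order_antisym T (R : rel T) :
  wochoice.well_order R -> antisymmetric R.
Proof.
move=> Rwo x y /andP[xy yx].
have Rxx w : R w w.
  have [|v [[/asboolP -> /(_ w)]]] := Rwo (fun v => `[< v = w >]).
    by exists w; apply/asboolP.
  by move=> wmin _; apply: wmin; exact/asboolP.
have [|v [_ vuniq]] := Rwo (fun v => `[< v = x \/ v = y >]).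
  by exists x; apply/asboolP; left.
have vx : v = x.
  by apply: vuniq; split; [by apply/asboolP; left|by move=> w /asboolP[]->].
have vy : v = y.
  by apply: vuniq; split; [by apply/asboolP; right|by move=> w /asboolP[]->].
by rewrite -vx.
Qed.

Lemma well_order_total T (R : rel T) : wochoice.well_order R -> total R.
Proof.
move=> Rwo x y.
have [|v [[/asboolP + vmin] _]] := Rwo (fun v => `[< v = x \/ v = y >]).
  by exists x; apply/asboolP; left.
have vx : R v x by apply: vmin; apply/asboolP; left.
have vy : R v y by apply: vmin; apply/asboolP; right.
by move=> [ve|ve]; [move: vy|move: vx]; rewrite ve => ->; rewrite ?orbT.
Qed.

Lemma Sym_in_S (p : Sym) : exists2 f, increasing f & S_ f p.
Proof.
pose q i := p i + (p^-1)%g i; pose f n := \sum_(i < n.+1) (q i).+1.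
have fS n : f n.+1 = f n + (q n.+1).+1 by rewrite /f big_ord_recr.
have fq n : q n <= f n.
  by case: n => [|n]; rewrite ?fS /f ?big_ord_recr /=; lia.
exists f; first by apply: homo_ltn ltn_trans _ => n; rewrite fS; lia.
apply: sub_gen_smallest; split;
  apply: (sub_cofinite_set _ (cofinite_setT _)) => n _ /=;
  apply: leq_trans (fq n).
- exact: leq_addr.
- exact: leq_addl.
Qed.

Lemma inj_card_leT (S T : Type) (f : S -> T) :
  injective f -> [set: S] #<= [set: T].
Proof.
move=> finj; rewrite -(card_le_eql (inj_card_eq (f := f) (in2W finj))).
exact: card_leT.
Qed.

Section chain.
Variables (U : set_system nat) (Unp : nonprincipal_ultrafilter U).
Variables (K : Type) (g : K -> nat -> nat).
Hypothesis g_nondecreasing : forall b, nondecreasing (g b).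
Hypothesis g_dominating : forall h, exists b, ev_le U h (g b).
Hypothesis interp : forall x, exists y, interpolates U x y.

(** The chain is indexed by those [b] whose [g b] strictly exceeds, modulo [U],
    all functions with smaller index in a well-ordering of [K]. *)
Lemma short_chain : exists (L : Type) (R : rel L),
  [set: L] #<= [set: K] /\ chain_length R.
Proof.
have [R0 R0wo] := wochoice.well_ordering_principle {classic K}.
pose R : rel K := R0; have Rwo : wochoice.well_order R := R0wo.
pose new (b : K) := forall b', R b' b -> ev_le U (g b) (g b') -> b' = b.
pose L := {b : K | `[< new b >]}.
have sval_inj : injective (@sval K (fun b => `[< new b >])).
  by move=> [i iP] [j jP] /= ij; subst j; congr exist; exact: bool_irrelevance.
have Lcof b : exists i : L, ev_le U (g b) (g (sval i)).
  have [|v [[/asboolP bv vmin] _]] := Rwo (fun v => `[< ev_le U (g b) (g v) >]).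
    by exists b; apply/asboolP; exact: ev_le_pointwise.
  have newv : `[< new v >].
    apply/asboolP => b' b'v vb'; apply: (well_order_antisym Rwo).
    by rewrite b'v vmin//; apply/asboolP; exact: ev_le_trans vb'.
  by exists (exist _ v newv).
exists L, (fun i j => R (sval i) (sval j)); split.
  exact: inj_card_leT sval_inj.
split.
  move=> A [i Ai].
  have [|v [[/asboolP[j Aj jv] vmin] vuniq]] :=
      Rwo (fun v => `[< exists2 j : L, j \in A & sval j = v >]).
    by exists (sval i); apply/asboolP; exists i.
  exists j; split.
    by split=> // k Ak; rewrite jv; apply: vmin; apply/asboolP; exists k.
  move=> k [Ak kmin]; apply: sval_inj; rewrite jv; apply: vuniq; split.
    by apply/asboolP; exists k.
  by move=> w /asboolP[l Al <-]; exact: kmin.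
exists (fun i => stab U (g (sval i))).
have absorb f : increasing f -> exists i : L, S_ f `<=` stab U (g (sval i)).
  move=> fi; have [b fb] := g_dominating (fun n => f n + n).
  have [i bi] := Lcof b; exists i; apply: (S_sub_stab Unp fi) => //.
  exact: ev_le_trans bi.
split=> // [i|i j ij|].
- by split; [exact: stab_subgroup|exact: stab_proper].
- have [ij'|ji] := ev_le_total Unp (g (sval i)) (g (sval j)).
    exact: stab_le.
  by have /asboolP/(_ _ ij ji)/sval_inj-> := svalP j.
- apply/seteqP; split=> // p _; have [f fi fp] := Sym_in_S p.
  by have [i fi'] := absorb f fi; exists i => //; exact: fi'.
Qed.

End chain.

Lemma cf_star_le (cf L : Type) (R : rel L) :
  is_cf_star_Sym cf -> chain_length R -> [set: cf] #<= [set: L].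
Proof.
move=> [R0 [R0wo _] /(_ L R)] + RL => /(_ RL)[f fR].
have finj : injective f.
  move=> x y fxy; apply: (well_order_antisym R0wo); rewrite -!fR fxy.
  by have := fR y y; have := well_order_total R0wo y y; rewrite orbb => -> ->.
exact: inj_card_leT finj.
Qed.

Theorem corollary1p11 (u s cf : Type)
    (hu : is_ultrafilter_number u) (hs : is_splitting_number s)
    (hcf : is_cf_star_Sym cf) :
  card_lt u s /\ card_lt u cf -> NCF.
Proof.
move=> [[_ us] [_ ucf]]; apply: contrapT => notNCF.
have [[Bs Bsbase Bsu] _] := hu; have [_ smin] := hs.
set V := filter_from Bs id in Bsbase.
have [U Unp UV] := not_NCF_separated Bsbase notNCF.
have [e eBs] : exists e : u -> set nat, range e = Bs.
  have := Bsu; rewrite card_eq_sym => /card_set_bijP[e [eB _ eS]].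
  by exists e; apply/seteqP; split=> [_ [b _ <-]|A /eS//]; exact: eB.
have eV b : V (e b) by exists (e b) => //; rewrite -eBs; exists b.
have Ve A : V A -> exists b, e b `<=` A.
  by move=> [B]; rewrite -eBs => -[b _ <-] bA; exists b.
have nosplit S : splitting_family S -> ~ (S #<= [set: u]).
  by move=> /smin sS Su; apply: us; exact: card_le_trans Su.
have interp := interpolation Unp Bsbase UV eV Ve nosplit.
have dom := next_dominating Unp Bsbase UV eV Ve.
have nd b : nondecreasing (next (e b)).
  by apply: next_nondecreasing; exact: np_infinite (eV b).
have [L [R [Lu RL]]] := short_chain Unp nd dom interp.
by apply: ucf; apply: card_le_trans Lu; exact: cf_star_le RL.
Qed.
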